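(* Let $\mathbf{J}$ be a chain and let $\mathbf{L}\le\mathbf{F}_n(\mathbf{J}\overrightarrow{\times}\mathbb{Z})$ be a proper $\ell$-pregroup of periodicity $n$ such that its group skeleton $\mathbf{L}_g$ is a totally ordered $\ell$-group, and let $i\in S:=\mathrm{supp}_{\mathrm{loc}}(\mathbf{L})$. Then there exists a sequence $(k_j)_{j\in S}$ of elements of $\mathbb{Z}_n=\{0,1,\dots,n-1\}$ such that for each $c\in L_{\mathrm{loc}}$ and each $j\in S$, $\overline{c}_j=\overline{c}_i^{[k_j]}$, and $k_i=0$. In particular, $\mathbf{L}_{\mathrm{loc}}\cong\mathbf{F}_n(\mathbb{Z})$.
   Context: An $\ell$-pregroup is an algebra $(A,\wedge,\vee,\cdot,1,{}^{\ell},{}^{r})$ such that $(A,\wedge,\vee)$ is a lattice, $(A,\cdot,1)$ is a monoid, multiplication is order-preserving in both arguments, and $a^{\ell}a\le 1\le aa^{\ell}$ and $aa^{r}\le 1\le a^{r}a$ for all $a\in A$. Write $x^{\ell^k}$, $x^{r^k}$ for the $k$-fold application of ${}^\ell$, ${}^r$; for $k\ge 0$ let $x^{[k]}:=x^{\ell^{2k}}$. An element $a$ is $k$-periodic if $a^{\ell^k}=a^{r^k}$ (equivalently $a^{[k]}=a$); its periodicity is the least $k\ge 1$ such that it is $k$-periodic. An $\ell$-pregroup is $n$-periodic if all its elements are, and it is of periodicity $n$ if it is $n$-periodic and contains an element of periodicity $n$. The group skeleton $\mathbf{L}_g$ is the subalgebra with universe $\{a\in L:a^\ell=a^r\}$,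 an $\ell$-group consisting of the invertible elements; $\mathbf{L}$ is proper if it is not an $\ell$-group, i.e. $\mathbf{L}\ne\mathbf{L}_g$. For a chain $\mathbf{\Omega}$, $\mathbf{F}(\mathbf{\Omega})$ is the $\ell$-pregroup of all maps $f\colon\Omega\to\Omega$ having residuals and dual residuals of all orders, i.e. such that all iterates of $f^\ell(q)=\min\{p:q\le f(p)\}$ and $f^r(q)=\max\{p:f(p)\le q\}$ exist and $f(p)\le q\Leftrightarrow p\le f^r(q)$ and $f^\ell(p)\le q\Leftrightarrow p\le f(q)$ (and likewise for the iterates), under composition, identity, pointwise order, ${}^\ell$, ${}^r$. $\mathbf{F}_n(\mathbf{\Omega})$ is its subalgebra of $n$-periodic elements. $\mathbf{F}(\mathbb{Z})$ consists of the order-preserving maps on $\mathbb{Z}$ with finite preimages of points, and $\mathbf{F}_n(\mathbb{Z})$ of those with $f(x+n)=f(x)+n$ for all $x$. $\mathbf{J}\overrightarrow{\times}\mathbb{Z}$ is $J\times\mathbb{Z}$ with the lexicographic order. It is known that for each $f\in\mathbf{F}_n(\mathbf{J}\overrightarrow{\times}\mathbb{Z})$ there are a unique order-automorphism $\widetilde f$ of $\mathbf{J}$ and a unique family $\overline f=(\overline f_j)_{j\in J}$ of elements of $\mathbf{F}_n(\mathbb{Z})$ with $f(j,m)=(\widetilde f(j),\overline f_j(m))$ for all $(j,m)\in J\times\mathbb{Z}$. For $\mathbf{L}\le\mathbf{F}_n(\mathbf{J}\overrightarrow{\times}\mathbb{Z})$ the local subalgebra $\mathbf{L}_{\mathrm{loc}}$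 has universe $L_{\mathrm{loc}}=\{f\in L:\widetilde f=\mathrm{id}\}$. For $f\in L_{\mathrm{loc}}$, $\mathrm{supp}(f)=\{j\in J:\overline f_j\ne 1\}$. If $\mathbf{L}$ is proper and $\mathbf{L}_g$ is totally ordered, all $a\in L_{\mathrm{loc}}\setminus\{1\}$ have the same support (and such $a$ exist), and $\mathrm{supp}_{\mathrm{loc}}(\mathbf{L})$ denotes this common support. *)

(* Defs.v *)
From HB Require Import structures.
From mathcomp Require Import all_boot all_order ssralg ssrnum ssrint.
From mathcomp Require Import boolp classical_sets functions.

Set Implicit Arguments.
Unset Strict Implicit.
Unset Printing Implicit Defensive.

Import Order.TTheory.

Local Open Scope classical_set_scope.
Local Open Scope order_scope.

HB.mixin Record Lattice_Monoid_isLPregroup d A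
    of Order.Lattice d A & Monoid A := {
  lpl : A -> A;
  lpr : A -> A;
  lp_mul_le : forall a b c e : A, a <= b -> c <= e -> (a * c)%g <= (b * e)%g;
  lp_lmul_le1 : forall a : A, (lpl a * a)%g <= (1%g : A);
  lp_mull_ge1 : forall a : A, (1%g : A) <= (a * lpl a)%g;
  lp_mulr_le1 : forall a : A, (a * lpr a)%g <= (1%g : A);
  lp_rmul_ge1 : forall a : A, (1%g : A) <= (lpr a * a)%g
}.

#[short(type="lpregroupType")]
HB.structure Definition LPregroup d :=
  { A of Order.Lattice d A & Monoid A & Lattice_Monoid_isLPregroup d A }.

Section PregroupNotions.
Context {d : Order.disp_t} {A : lpregroupType d}.
Implicit Types (a x : A) (L : set A) (k n : nat).

(* x^[k] is the 2k-fold application of ^l to x. *)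
Definition lpbr x k : A := iter k.*2 lpl x.

Definition periodic n a : Prop := iter n lpl a = iter n lpr a.

Definition elt_periodicity a n : Prop :=
  [/\ (0 < n)%N, periodic n a
    & forall k, (0 < k)%N -> periodic k a -> (n <= k)%N].

Definition has_periodicity L n : Prop :=
  L `<=` [set a | periodic n a] /\ exists2 a, L a & elt_periodicity a n.

Record subalgebra L : Prop := Subalgebra {
  subalg_one : L 1%g;
  subalg_mul : forall a b, L a -> L b -> L (a * b)%g;
  subalg_meet : forall a b, L a -> L b -> L (a `&` b)%O;
  subalg_join : forall a b, L a -> L b -> L (a `|` b)%O;
  subalg_lpl : forall a, L a -> L (lpl a);
  subalg_lpr : forall a, L a -> L (lpr a)
}.

Definition skeleton L : set A := L `&` [set a | lpl a = lpr a].

Definition is_proper L : Prop := skeleton L <> L.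

End PregroupNotions.

Record is_isomorphism {d d' : Order.disp_t}
    {A : lpregroupType d} {B : lpregroupType d'}
    (L : set A) (M : set B) (phi : A -> B) : Prop := IsIsomorphism {
  iso_bij : set_bij L M phi;
  iso_one : phi 1%g = 1%g;
  iso_mul : {in L &, {morph phi : a b / (a * b)%g}};
  iso_meet : {in L &, {morph phi : a b / (a `&` b)%O}};
  iso_join : {in L &, {morph phi : a b / (a `|` b)%O}};
  iso_lpl : {in L, {morph phi : a / lpl a}};
  iso_lpr : {in L, {morph phi : a / lpr a}}
}.

Definition isomorphic {d d' : Order.disp_t}
    {A : lpregroupType d} {B : lpregroupType d'}
    (L : set A) (M : set B) : Prop :=
  exists phi : A -> B, is_isomorphism L M phi.

Section Residuals.
Context {d : Order.disp_t} {W : orderType d}.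
Implicit Types f g h : W -> W.

(* When the minimum or maximum does not exist, these have a junk value; the
   predicate [residuated] below excludes that case. *)
Definition lres f (q : W) : W :=
  xget q [set p | q <= f p /\ forall p', q <= f p' -> p <= p'].
Definition rres f (q : W) : W :=
  xget q [set p | f p <= q /\ forall p', f p' <= q -> p' <= p].

Definition adjoint f g : Prop := forall p q, (f p <= q) = (p <= g q).

Definition residuated f : Prop := forall k : nat,
  adjoint (iter k rres f) (iter k.+1 rres f) /\
  adjoint (iter k.+1 lres f) (iter k lres f).

Lemma adjoint_rres f g : adjoint f g -> rres f = g.
Proof.
move=> fg; apply/funext => q; apply: xget_unique => [|p [fp pmax]] /=.
  by rewrite fg; split=> // p'; rewrite fg.
by apply/le_anti; rewrite -fg fp pmax // fg.
Qed.

Lemma adjoint_lres f g : adjoint f g -> lres g = f.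
Proof.
move=> fg; apply/funext => q; apply: xget_unique => [|p [fp pmin]] /=.
  by rewrite -fg; split=> // p'; rewrite -fg.
by apply/le_anti; rewrite fg fp pmin // -fg.
Qed.

Lemma residuated_adjr f : residuated f -> adjoint f (rres f).
Proof. by move=> /(_ 0%N)[]. Qed.

Lemma residuated_adjl f : residuated f -> adjoint (lres f) f.
Proof. by move=> /(_ 0%N)[]. Qed.

Lemma residuated_rres f : residuated f -> residuated (rres f).
Proof.
move=> rf k; have lr := adjoint_lres (residuated_adjr rf); split.
  by rewrite -!iterSr; have [] := rf k.+1.
case: k => [|k]; first by rewrite /= lr; have [] := rf 0%N.
by rewrite (iterSr k.+1) (iterSr k _ (rres f)) lr; have [] := rf k.
Qed.

Lemma residuated_lres f : residuated f -> residuated (lres f).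
Proof.
move=> rf k; have rl := adjoint_rres (residuated_adjl rf); split.
  case: k => [|k]; first by rewrite /= rl; have [] := rf 0%N.
  by rewrite (iterSr k.+1) (iterSr k _ (lres f)) rl; have [] := rf k.
by rewrite -!iterSr; have [] := rf k.+1.
Qed.

Lemma residuated_coind (P : (W -> W) -> Prop) :
  (forall f, P f -> exists g h,
     [/\ adjoint f g, adjoint h f, P g & P h]) ->
  forall f, P f -> residuated f.
Proof.
move=> H f Pf k.
have Pr : P (iter k rres f).
  by elim: k => //= k /H[g [h [/adjoint_rres-> _ ? _]]].
have Pl : P (iter k lres f).
  by elim: k {Pr} => //= k /H[g [h [_ /adjoint_lres-> _ ?]]].
split.
  by have [g [h [fg _ _ _]]] := H _ Pr; rewrite /= (adjoint_rres fg).
by have [g [h [_ hf _ _]]] := H _ Pl; rewrite /= (adjoint_lres hf).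
Qed.

Lemma residuated_id : residuated id.
Proof. by apply: (residuated_coind (P := eq id)) => // f <-; exists id, id; split. Qed.

Lemma residuated_comp f g : residuated f -> residuated g -> residuated (f \o g).
Proof.
move=> rf rg.
apply: (residuated_coind (P :=
  fun h => exists f g, [/\ residuated f, residuated g & h = f \o g])).
  move=> _ [{rf}f [{rg}g [rf rg ->]]].
  have [rf1 lf1] := (residuated_adjr rf, residuated_adjl rf).
  have [rg1 lg1] := (residuated_adjr rg, residuated_adjl rg).
  exists (rres g \o rres f), (lres g \o lres f); split.
  - by move=> p q /=; rewrite rf1 rg1.
  - by move=> p q /=; rewrite lg1 lf1.
  - by exists (rres g), (rres f); split=> //; exact: residuated_rres.
  - by exists (lres g), (lres f); split=> //; exact: residuated_lres.
by exists f, g.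
Qed.

Lemma residuated_meet_join f g : residuated f -> residuated g ->
  residuated (fun x => f x `&` g x)%O /\ residuated (fun x => f x `|` g x)%O.
Proof.
move=> rf rg.
pose P h := exists f g, [/\ residuated f, residuated g &
  h = (fun x => f x `&` g x)%O \/ h = (fun x => f x `|` g x)%O].
suff H : forall h, P h -> residuated h.
  by split; apply: H; exists f, g; split=> //; [left|right].
apply: residuated_coind => h [{rf}f [{rg}g [rf rg hE]]].
have [rf1 lf1] := (residuated_adjr rf, residuated_adjl rf).
have [rg1 lg1] := (residuated_adjr rg, residuated_adjl rg).
have [rrf rrg] := (residuated_rres rf, residuated_rres rg).
have [rlf rlg] := (residuated_lres rf, residuated_lres rg).
case: hE => ->.
  exists (fun x => rres f x `|` rres g x)%O, (fun x => lres f x `|` lres g x)%O.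
  split.
  - by move=> p q; rewrite leIx lexU rf1 rg1.
  - by move=> p q; rewrite leUx lexI lf1 lg1.
  - by exists (rres f), (rres g); split=> //; right.
  - by exists (lres f), (lres g); split=> //; right.
exists (fun x => rres f x `&` rres g x)%O, (fun x => lres f x `&` lres g x)%O.
split.
- by move=> p q; rewrite leUx lexI rf1 rg1.
- by move=> p q; rewrite leIx lexU lf1 lg1.
- by exists (rres f), (rres g); split=> //; left.
- by exists (lres f), (lres g); split=> //; left.
Qed.

End Residuals.

(* The l-pregroup F(W) of a chain W. *)
Record resmap {d : Order.disp_t} (W : orderType d) := Resmap {
  resmap_fun :> W -> W;
  resmapP : residuated resmap_fun
}.

Section ResmapLPregroup.
Context {d : Order.disp_t} {W : orderType d}.
Implicit Types f g h : resmap W.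

Lemma resmap_eq f g : (f : W -> W) = g -> f = g.
Proof.
by case: f g => [f rf] [g rg] /= fg; subst g; congr Resmap; exact: Prop_irrelevance.
Qed.

HB.instance Definition _ := gen_eqMixin (resmap W).
HB.instance Definition _ := gen_choiceMixin (resmap W).

Definition resmap_le f g : bool := `[< forall x, f x <= g x >].

Lemma resmap_le_refl : reflexive resmap_le.
Proof. by move=> f; apply/asboolP. Qed.

Lemma resmap_le_anti : antisymmetric resmap_le.
Proof.
move=> f g /andP[/asboolP fg /asboolP gf]; apply/resmap_eq/funext => x.
by apply/le_anti; rewrite fg gf.
Qed.

Lemma resmap_le_trans : transitive resmap_le.
Proof.
by move=> g f h /asboolP fg /asboolP gh; apply/asboolP => x; exact: le_trans (gh x).
Qed.

HB.instance Definition _ := Order.Le_isPOrder.Build d (resmap W)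
  resmap_le_refl resmap_le_anti resmap_le_trans.

Lemma resmap_leP f g : reflect (forall x, f x <= g x) (f <= g).
Proof. exact: asboolP. Qed.

Definition resmap_meet f g : resmap W :=
  Resmap (residuated_meet_join (resmapP f) (resmapP g)).1.
Definition resmap_join f g : resmap W :=
  Resmap (residuated_meet_join (resmapP f) (resmapP g)).2.

Lemma resmap_lexI f g h : (f <= resmap_meet g h) = (f <= g) && (f <= h).
Proof.
apply/resmap_leP/andP => [fgh|[/resmap_leP fg /resmap_leP fh] x].
  by split; apply/resmap_leP => x; have := fgh x; rewrite lexI => /andP[].
by rewrite lexI fg fh.
Qed.

Lemma resmap_leUx f g h : (resmap_join f g <= h) = (f <= h) && (g <= h).
Proof.
apply/resmap_leP/andP => [fgh|[/resmap_leP fh /resmap_leP gh] x].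
  by split; apply/resmap_leP => x; have := fgh x; rewrite leUx => /andP[].
by rewrite leUx fh gh.
Qed.

HB.instance Definition _ := Order.POrder_MeetJoin_isLattice.Build d (resmap W)
  resmap_lexI resmap_leUx.

Definition resmap_one : resmap W := Resmap residuated_id.
Definition resmap_mul f g : resmap W :=
  Resmap (residuated_comp (resmapP f) (resmapP g)).

Lemma resmap_mulA : associative resmap_mul.
Proof. by move=> f g h; apply: resmap_eq. Qed.
Lemma resmap_mul1 : left_id resmap_one resmap_mul.
Proof. by move=> f; apply: resmap_eq. Qed.
Lemma resmap_mulr1 : right_id resmap_one resmap_mul.
Proof. by move=> f; apply: resmap_eq. Qed.

HB.instance Definition _ := isMonoid.Build (resmap W)
  resmap_mulA resmap_mul1 resmap_mulr1.

Definition resmap_l f : resmap W := Resmap (residuated_lres (resmapP f)).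
Definition resmap_r f : resmap W := Resmap (residuated_rres (resmapP f)).

Lemma resmap_mono f x y : x <= y -> f x <= f y.
Proof.
move=> xy; have adj := residuated_adjr (resmapP f).
by rewrite adj; apply: le_trans xy _; rewrite -adj.
Qed.

Lemma resmap_mul_le f g h e : f <= g -> h <= e -> (f * h)%g <= (g * e)%g.
Proof.
move=> /resmap_leP fg /resmap_leP he; apply/resmap_leP => x.
by apply: le_trans (fg _) _; apply: resmap_mono.
Qed.

Lemma resmap_lmul_le1 f : (resmap_l f * f)%g <= (1%g : resmap W).
Proof. by apply/resmap_leP => x /=; rewrite (residuated_adjl (resmapP f)). Qed.
Lemma resmap_mull_ge1 f : (1%g : resmap W) <= (f * resmap_l f)%g.
Proof. by apply/resmap_leP => x /=; rewrite -(residuated_adjl (resmapP f)). Qed.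
Lemma resmap_mulr_le1 f : (f * resmap_r f)%g <= (1%g : resmap W).
Proof. by apply/resmap_leP => x /=; rewrite (residuated_adjr (resmapP f)). Qed.
Lemma resmap_rmul_ge1 f : (1%g : resmap W) <= (resmap_r f * f)%g.
Proof. by apply/resmap_leP => x /=; rewrite -(residuated_adjr (resmapP f)). Qed.

HB.instance Definition _ := Lattice_Monoid_isLPregroup.Build d (resmap W)
  resmap_mul_le resmap_lmul_le1 resmap_mull_ge1 resmap_mulr_le1 resmap_rmul_ge1.

End ResmapLPregroup.

Definition Fn {d : Order.disp_t} (n : nat) (W : orderType d) : set (resmap W) :=
  [set f | periodic n f].
Arguments Fn {d} n W.

Definition order_automorphism {d : Order.disp_t} {J : orderType d}
    (s : J -> J) : Prop :=
  bijective s /\ {mono s : x y / x <= y}.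

Section Local.
Context {d : Order.disp_t} {J : orderType d} (n : nat).
Implicit Types (f : resmap (J *l int)) (L : set (resmap (J *l int))).

Definition decomposition f (s : J -> J) (fb : J -> resmap int) : Prop :=
  [/\ order_automorphism s, forall j, Fn n int (fb j)
    & forall (j : J) (m : int), f (j, m) = (s j, fb j m)].

(* For f in F_n(J x Z) the decomposition exists and is unique, so that the
   default values are irrelevant. *)
Definition tilde f : J -> J :=
  xget (id : J -> J) [set s | exists fb, decomposition f s fb].
Definition bar f : J -> resmap int :=
  xget ((fun=> 1%g) : J -> resmap int) [set fb | exists s, decomposition f s fb].

Definition Lloc L : set (resmap (J *l int)) := L `&` [set f | tilde f = id].

Definition supp f : set J := [set j | bar f j <> 1%g].

(* The set S, if any, such that supp f = S for all f in L_loc \ {1} and such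
   f exist. *)
Definition supp_loc L : set J :=
  xget set0 [set S | [set supp f | f in Lloc L `\ 1%g] = [set S]].

End Local.

(* Main.v *)
Require Import Defs.
From mathcomp Require Import all_boot all_order ssralg ssrnum ssrint intdiv.
From mathcomp Require Import boolp classical_sets functions zify.

Set Implicit Arguments.
Unset Strict Implicit.
Unset Printing Implicit Defensive.

Import Order.TTheory GRing.Theory Num.Theory.

Local Open Scope classical_set_scope.

(** Why the theorem holds.  On a chain in which every element has a successor
    and a predecessor, applying ^l twice conjugates by the successor map, so
    x^[k] is conjugation by the shift by k, and a map is n-periodic when it
    commutes with the shift by n ([lpbr_shift], [periodic_shift]).

    Put c_j for the component of c at j.  For i in S the map c |-> c_i is a
    homomorphism of L_loc into F_n(Z), and it is an order embedding:
    a <= c says that the meet of 1 and a^r c is 1, and an element of L_loc is 1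
    as soon as its component at i is 1, all other elements having support S
    ([bar_le]).

    It is onto.  Among the g >= 1 in L_loc whose component at i fixes 0, take
    one with as few fixed points modulo n as possible; products intersect sets
    of fixed points, so the fixed points of g_i are fixed by every competitor.
    If g_i fixed some b with 0 < b < n then, after conjugating by shifts, the
    fixed points of e_i would be stable under adding b for every closure
    operator e in L_loc, so that e^[b] = e ([lpbr_fix_idempotent]).  For an element a of periodicity n this applies to
    a^r a and a a^l, which record the fibres and the image of a.  Two maps with
    the same fibres and the same image are comparable along each orbit of the
    shift, and this forces a^[b] = a ([lpbr_fix_of_lpr_lpl]), against the
    choice of a.  Hence g_i fixes only multiples of n, and its n-th power is
    the map sending x to the least multiple of n that is at least x, called
    [ceilmul] below.  When n > 1 this single map generates F_n(Z)
    ([ceilmul_generates]): residuals and products yield all n-periodic maps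
    that are constant on consecutive blocks of length n, and every element of
    F_n(Z) is a join of n of those.

    Finally the closure operators x |-> (least y >= x congruent to k mod n)
    are the maximal ones in F_n(Z), so the automorphism of F_n(Z) relating the
    components at i and j sends [ceilmul] to some [ceilmul]^[k]; it agrees with
    x |-> x^[k] on a generator, hence everywhere ([bar_conjugate]). *)

(** * l-pregroups and residuated maps *)

Section Pregroups.
Context {d : Order.disp_t} {A : lpregroupType d}.
Implicit Types a b c : A.

(** Residuation: [lpr a * b] is the residual of [b] by [a]. *)
Lemma le_lpr_mul a b : (a <= b)%O <-> (1%g <= (lpr a * b)%g)%O.
Proof.
split=> ab.
  by apply: le_trans (lp_rmul_ge1 a) _; apply: lp_mul_le.
have := lp_mul_le _ _ _ _ (lexx a) ab; rewrite mulg1 mulgA => /le_trans; apply.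
by have := lp_mul_le _ _ _ _ (lp_mulr_le1 a) (lexx b); rewrite mul1g.
Qed.

Lemma lpbrS a k : lpbr a k.+1 = lpl (lpl (lpbr a k)).
Proof. by []. Qed.

Lemma lpbr_lpl a k : lpbr (lpl a) k = lpl (lpbr a k).
Proof. by rewrite /lpbr -iterS -iterSr. Qed.

Lemma subalgebra_lpbr (L : set A) a k : subalgebra L -> L a -> L (lpbr a k).
Proof. by move=> SL La; rewrite /lpbr; elim: k.*2 => //= m /(subalg_lpl SL). Qed.

End Pregroups.

Section Resmaps.
Context {d : Order.disp_t} {W : orderType d}.
Implicit Types f g : resmap W.

Lemma resmap_ext f g : f =1 g -> f = g.
Proof. by move=> fg; apply/resmap_eq/funext. Qed.

Lemma lpl_adj f x y : (lpl f x <= y)%O = (x <= f y)%O.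
Proof. exact: (residuated_adjl (resmapP f)). Qed.

Lemma lpr_adj f x y : (f x <= y)%O = (x <= lpr f y)%O.
Proof. exact: (residuated_adjr (resmapP f)). Qed.

Lemma lpl_unique f g : (forall x y, (g x <= y)%O = (x <= f y)%O) -> lpl f = g.
Proof. by move=> gf; apply: resmap_eq; exact: adjoint_lres. Qed.

Lemma lpr_unique f g : (forall x y, (f x <= y)%O = (x <= g y)%O) -> lpr f = g.
Proof. by move=> gf; apply: resmap_eq; exact: adjoint_rres. Qed.

Lemma lpl_lpr f : lpl (lpr f) = f.
Proof. exact/lpl_unique/lpr_adj. Qed.

Lemma lpr_lpl f : lpr (lpl f) = f.
Proof. exact/lpr_unique/lpl_adj. Qed.

Lemma iter_lplr k f : iter k lpl (iter k lpr f) = f.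
Proof. by elim: k f => //= k IH f; rewrite -iterS iterSr lpl_lpr IH. Qed.

Lemma iter_lprl k f : iter k lpr (iter k lpl f) = f.
Proof. by elim: k f => //= k IH f; rewrite -iterS iterSr lpr_lpl IH. Qed.

Lemma periodic_lpbr k f : periodic k f <-> lpbr f k = f.
Proof.
rewrite /lpbr -addnn iterD; split=> [->|fk]; first by rewrite iter_lplr.
by rewrite /periodic -{2}fk iter_lprl.
Qed.

Lemma lpbr_lpr f k : lpbr (lpr f) k = lpr (lpbr f k).
Proof. by rewrite -[lpbr (lpr f) k]lpr_lpl -lpbr_lpl lpl_lpr. Qed.

Lemma Fn_lpl n f : Fn n W f -> Fn n W (lpl f).
Proof. by move=> /periodic_lpbr fn; apply/periodic_lpbr; rewrite lpbr_lpl fn. Qed.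

Lemma Fn_lpr n f : Fn n W f -> Fn n W (lpr f).
Proof. by move=> /periodic_lpbr fn; apply/periodic_lpbr; rewrite lpbr_lpr fn. Qed.

End Resmaps.

(** * Chains with a shift *)

(** The last field says that [sh 1] is the successor map, so that a chain with
    a shift is a disjoint union of copies of the integers. *)
Record is_shift {d : Order.disp_t} {W : orderType d} (sh : int -> W -> W) :
    Prop := IsShift {
  shift0 : forall x, sh 0%R x = x;
  shiftD : forall a b x, sh (a + b)%R x = sh a (sh b x);
  shift_lt : forall x y, (x < y)%O = (sh 1%R x <= y)%O
}.

Section Shifts.
Context {d : Order.disp_t} {W : orderType d}.
Context (sh : int -> W -> W) (shP : is_shift sh).
Implicit Types f g : resmap W.

Lemma shiftK a x : sh a (sh (- a)%R x) = x.
Proof. by rewrite -shiftD // addrN shift0. Qed.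

Lemma shiftNK a x : sh (- a)%R (sh a x) = x.
Proof. by rewrite -shiftD // addNr shift0. Qed.

Lemma shift1_le x y : (sh 1%R x <= sh 1%R y)%O = (x <= y)%O.
Proof.
rewrite -(shift_lt shP); apply/idP/idP => [|xy].
  by rewrite ltNge; case: (leP x y) => // yx; rewrite -(shift_lt shP) yx.
by apply: le_lt_trans xy _; rewrite (shift_lt shP).
Qed.

Lemma shift_nat_le (k : nat) x y : (sh k%:Z x <= sh k%:Z y)%O = (x <= y)%O.
Proof.
elim: k => [|k IH] in x y *; first by rewrite !(shift0 shP).
by rewrite intS !(shiftD shP) shift1_le IH.
Qed.

Lemma shift_le a x y : (sh a x <= sh a y)%O = (x <= y)%O.
Proof.
case: a => k; first exact: shift_nat_le.
by rewrite NegzE -(shift_nat_le k.+1) !shiftK.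
Qed.

(** Both residuations turn an inequality around: [q <= f p] fails exactly when
    [f p < q], that is when the successor of [f p] is at most [q]. *)
Lemma lplpl_shift f x : lpl (lpl f) x = sh 1%R (f (sh (-1)%R x)).
Proof.
apply/le_anti/andP; split.
  rewrite lpl_adj -(shiftK 1 x) -(shift_lt shP) shiftNK -(shiftK 1 x).
  by rewrite ltNge lpl_adj -ltNge (shift_lt shP) !shiftK.
rewrite -(shift_lt shP) ltNge -(lpl_adj f) -ltNge (shift_lt shP) shiftK.
by rewrite -(lpl_adj (lpl f)).
Qed.

Lemma lpbr_shift f k x : lpbr f k x = sh k%:Z (f (sh (- k%:Z)%R x)).
Proof.
elim: k => [|k IH] in x *; first by rewrite oppr0 !(shift0 shP).
by rewrite lpbrS lplpl_shift IH !intS opprD -!(shiftD shP) [(-1 - _)%R]addrC.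
Qed.

Lemma lpbr_shiftE f k x : lpbr f k (sh k%:Z x) = sh k%:Z (f x).
Proof. by rewrite lpbr_shift shiftNK. Qed.

Lemma periodic_shift k f :
  periodic k f <-> (forall x, f (sh k%:Z x) = sh k%:Z (f x)).
Proof.
rewrite periodic_lpbr; split=> [fk x|fk]; first by rewrite -{1}fk lpbr_shiftE.
by apply: resmap_ext => x; rewrite lpbr_shift -fk shiftK.
Qed.

Lemma periodic_shiftM k f (t : int) x :
  periodic k f -> f (sh (t * k%:Z)%R x) = sh (t * k%:Z)%R (f x).
Proof.
move=> /periodic_shift fk; have fnat (m : nat) y :
    f (sh (m%:Z * k%:Z)%R y) = sh (m%:Z * k%:Z)%R (f y).
  elim: m => [|m IH]; first by rewrite mul0r !(shift0 shP).
  by rewrite intS mulrDl mul1r !(shiftD shP) fk IH.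
case: t => m //; rewrite NegzE mulNr.
by rewrite -{2}[x](shiftK (m.+1%:Z * k%:Z)%R) fnat shiftNK.
Qed.

Lemma lpbr_le f g k : (f <= g)%O -> (lpbr f k <= lpbr g k)%O.
Proof.
move=> /resmap_leP fg; apply/resmap_leP => x.
by rewrite !lpbr_shift shift_le fg.
Qed.

Lemma lpbr1 k : lpbr (1%g : resmap W) k = 1%g.
Proof. by apply: resmap_ext => x; rewrite lpbr_shift /= shiftK. Qed.

Lemma lpbr_mul f g k : lpbr (f * g)%g k = (lpbr f k * lpbr g k)%g.
Proof.
apply: resmap_ext => x; rewrite [RHS]/= !lpbr_shift.
by rewrite shiftNK.
Qed.

Lemma lpbr_meet f g k : lpbr (f `&` g)%O k = (lpbr f k `&` lpbr g k)%O.
Proof.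
apply: resmap_ext => x; rewrite [RHS]/= !lpbr_shift /=.
by rewrite !meetEtotal !minEle shift_le; case: ifP.
Qed.

Lemma lpbr_join f g k : lpbr (f `|` g)%O k = (lpbr f k `|` lpbr g k)%O.
Proof.
apply: resmap_ext => x; rewrite [RHS]/= !lpbr_shift /=.
by rewrite !joinEtotal !maxEle shift_le; case: ifP.
Qed.

Lemma lpbrD f k l : lpbr f (k + l) = lpbr (lpbr f k) l.
Proof. by rewrite /lpbr doubleD addnC iterD. Qed.

Lemma lpbr_periodM f n k : Fn n W f -> lpbr f (k * n) = f.
Proof.
move=> /periodic_lpbr fn; elim: k => [//|k IH].
by rewrite mulSn lpbrD fn.
Qed.

(** If [f <= f^[k]] then the iterates of [^[k]] on [f] increase, and the [n]-th
    one is [f] again. *)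
Lemma lpbr_fix_of_le f n k : (0 < n)%N -> Fn n W f ->
  (f <= lpbr f k)%O -> lpbr f k = f.
Proof.
move=> n_gt0 fn fk.
have um : {homo (fun m => lpbr f (m * k)) : a b / (a <= b)%N >-> (a <= b)%O}.
  apply: homo_leq => [//|? ? ?|m]; first exact: le_trans.
  by rewrite mulSn lpbrD; apply: lpbr_le.
apply/le_anti; rewrite fk andbT.
by have := um _ _ n_gt0; rewrite mul1n mulnC lpbr_periodM.
Qed.

End Shifts.

(** * Maps with the same fibres and the same image *)

Section FibresImages.
Context {d : Order.disp_t} {W : orderType d}.
Implicit Types f g h : resmap W.

Lemma resmap_lprK f x : f (lpr f (f x)) = f x.
Proof.
apply/le_anti/andP; split; first by rewrite lpr_adj.
by apply: resmap_mono; rewrite -lpr_adj.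
Qed.

Lemma resmap_lplK f x : f (lpl f (f x)) = f x.
Proof.
apply/le_anti/andP; split; last by rewrite -lpl_adj.
by apply: resmap_mono; rewrite lpl_adj.
Qed.

(** [lpr f * f] sends a point to the largest point of its [f]-fibre. *)
Lemma same_fibres f h x y :
  (lpr f * f)%g = (lpr h * h)%g -> f x = f y -> h x = h y.
Proof.
move=> fh fxy; have E z : lpr h (h z) = lpr f (f z).
  by rewrite -[LHS]/((lpr h * h)%g z) -fh.
by rewrite -(resmap_lprK h x) -(resmap_lprK h y) !E fxy.
Qed.

(** The fixed points of [f * lpl f] are the values of [f]. *)
Lemma same_image f h x :
  (f * lpl f)%g = (h * lpl h)%g -> h (lpl h (f x)) = f x.
Proof.
move=> fh; rewrite -[RHS](resmap_lplK f) -[LHS]/((h * lpl h)%g (f x)).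
by rewrite -fh.
Qed.

Lemma lpr_mul_idem f : ((lpr f * f) * (lpr f * f))%g = (lpr f * f)%g.
Proof. by apply: resmap_ext => x; exact: (congr1 (lpr f) (resmap_lprK f x)). Qed.

Lemma mul_lpl_idem f : ((f * lpl f) * (f * lpl f))%g = (f * lpl f)%g.
Proof. by apply: resmap_ext => x; exact: resmap_lplK. Qed.

Lemma resmap_lt f x y : (f x < f y)%O -> (x < y)%O.
Proof. by rewrite !ltNge; apply: contra; apply: resmap_mono. Qed.

Context (sh : int -> W -> W) (shP : is_shift sh).

(** If [f] and [h] have the same fibres and the same image, then moving one
    step up the chain either changes neither value or moves both to the next
    value in the common image; so an inequality at one point spreads over the
    orbit of that point. *)
Section Comparison.
Context (f h : resmap W) (same_lpr : (lpr f * f)%g = (lpr h * h)%g)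
  (same_lpl : (f * lpl f)%g = (h * lpl h)%g).

Lemma le_succ x : (h x <= f x)%O -> (h (sh 1%R x) <= f (sh 1%R x))%O.
Proof.
move=> hf; have : (f x <= f (sh 1%R x))%O.
  by apply: resmap_mono; rewrite ltW // (shift_lt shP).
rewrite le_eqVlt => /orP[/eqP/esym fE|flt].
  by rewrite fE (same_fibres same_lpr fE).
rewrite leNgt; apply/negP => fh.
have := fh; rewrite -{1}(same_image (sh 1%R x) same_lpl) => /resmap_lt.
rewrite ltNge => /negP; apply; rewrite -(shift_lt shP) ltNge; apply/negP.
move=> /(resmap_mono h); rewrite same_image // => /le_trans/(_ hf).
by rewrite leNgt flt.
Qed.

Lemma le_pred x : (h (sh 1%R x) <= f (sh 1%R x))%O -> (h x <= f x)%O.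
Proof.
move=> hf; have : (h x <= h (sh 1%R x))%O.
  by apply: resmap_mono; rewrite ltW // (shift_lt shP).
rewrite le_eqVlt => /orP[/eqP hE|hlt].
  by rewrite hE (same_fibres (esym same_lpr) hE).
rewrite leNgt; apply/negP => fh.
have := fh; rewrite -{1}(same_image x (esym same_lpl)) => /resmap_lt.
rewrite (shift_lt shP) => /(resmap_mono f); rewrite same_image //.
by move=> /(le_trans hf); rewrite leNgt hlt.
Qed.

Lemma le_orbit x a : (h x <= f x)%O -> (h (sh a x) <= f (sh a x))%O.
Proof.
move=> hf; case: a => k.
  elim: k => [|k IH]; first by rewrite (shift0 shP).
  by rewrite intS (shiftD shP); apply: le_succ.
rewrite NegzE; elim: k.+1 => [|{}k IH]; first by rewrite (shift0 shP).
apply: le_pred; rewrite -(shiftD shP).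
by rewrite intS opprD addrA addrN add0r.
Qed.

End Comparison.

(** A map whose fibres and image are stable under the shift by [k] commutes
    with it: at a point [x], the map and its conjugate are comparable on the
    whole orbit of [x], so the sequence [u] below is monotone, and it takes the
    same value at 0 and at [n] because the map is [n]-periodic. *)
Lemma lpbr_fix_of_lpr_lpl f n k : (0 < n)%N -> Fn n W f ->
  lpbr (lpr f * f)%g k = (lpr f * f)%g -> lpbr (f * lpl f)%g k = (f * lpl f)%g ->
  lpbr f k = f.
Proof.
move=> n_gt0 fn; rewrite !(lpbr_mul shP) lpbr_lpr lpbr_lpl => fr fl.
suff fk x : f (sh k%:Z x) = sh k%:Z (f x).
  by apply: resmap_ext => x; rewrite (lpbr_shift shP) -fk (shiftK shP).
pose u (m : nat) := sh (- (m%:Z * k%:Z))%R (f (sh (m%:Z * k%:Z)%R x)).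
have u0 : u 0%N = f x by rewrite /u mul0r oppr0 !(shift0 shP).
have un : u n = f x.
  by rewrite /u mulrC (periodic_shiftM shP _ _ fn) (shiftNK shP).
have uS (r : rel W) m : {mono sh (- (m.+1%:Z * k%:Z))%R : a b / r a b} ->
    r (lpbr f k (sh (m.+1%:Z * k%:Z)%R x)) (f (sh (m.+1%:Z * k%:Z)%R x)) ->
    r (u m) (u m.+1).
  move=> rm; rewrite -rm; congr (r _ _).
  rewrite (lpbr_shift shP) -!(shiftD shP); congr (sh _ (f (sh _ _))); lia.
suff u1 : u 1%N = f x.
  by rewrite -u1 /u mul1r (shiftK shP).
have [fx|/ltW fx] := leP (lpbr f k x) (f x).
  have um : {homo u : a b / (a <= b)%N >-> (a <= b)%O}.
    apply: homo_leq => [//|? ? ?|m]; first exact: le_trans.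
    apply: (uS <=%O) => [? ?|]; first exact: (shift_le shP).
    exact: le_orbit.
  by apply/le_anti; rewrite -{1}un -u0 !um.
have um : {homo u : a b / (a <= b)%N >-> (a >= b)%O}.
  apply: homo_leq => [//|? ? ? yx zy|m]; first exact: le_trans zy yx.
  apply: (uS >=%O) => [? ?|]; first exact: (shift_le shP).
  exact: le_orbit.
by apply/le_anti; rewrite -{2}un -u0 !um.
Qed.

End FibresImages.

(** * Decomposition of n-periodic maps on J x Z *)

Lemma int_is_shift : is_shift (fun a x : int => (x + a)%R).
Proof. by split=> [x|a b x|x y]; lia. Qed.

Section Fibres.
Context {d : Order.disp_t} {J : orderType d}.
Implicit Types (j : J) (m p q : int).
Local Notation W := (J *l int)%type.

Definition lex_shift (a : int) (x : W) : W := (x.1, x.2 + a)%R.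

Lemma lex_is_shift : is_shift lex_shift.
Proof.
split=> [[j m]|a b [j m]|[j m] [j' m']]; rewrite /lex_shift /=.
- by rewrite addr0.
- by rewrite [(a + b)%R]addrC addrA.
- by rewrite ltxi_pair lexi_pair lezD1.
Qed.

Lemma lex_fibre_le j p q : (((j, p) : W) <= ((j, q) : W))%O = (p <= q)%O.
Proof. by rewrite lexi_pair lexx. Qed.

Context (n : nat) (n_gt0 : (0 < n)%N).
Implicit Types f : resmap W.

Definition fibre_map f j : J := (f (j, 0%R)).1.
Definition fibre_fun f j m : int := (f (j, m)).2.

Lemma Fn_lex f j m (t : int) : Fn n W f ->
  f (j, m + t * n%:Z)%R = ((f (j, m)).1, (f (j, m)).2 + t * n%:Z)%R.
Proof. by move=> /(periodic_shiftM lex_is_shift t (j, m)%R). Qed.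

(** By periodicity [f] maps arbitrarily low and arbitrarily high points of a
    fibre into one fibre, and by monotonicity also the points between them. *)
Lemma fibre_mapE f j m : Fn n W f -> f (j, m) = (fibre_map f j, fibre_fun f j m).
Proof.
move=> fn; rewrite [LHS]surjective_pairing /fibre_map; congr pair.
have lo : (((j, - `|m| * n%:Z)%R : W) <= ((j, m) : W))%O by rewrite lex_fibre_le; nia.
have hi : (((j, m) : W) <= ((j, `|m| * n%:Z)%R : W))%O by rewrite lex_fibre_le; nia.
apply/le_anti; have := (resmap_mono f lo, resmap_mono f hi).
rewrite -[(_ * _)%R]add0r -[(`|_| * _)%R]add0r !Fn_lex //.
by rewrite !leEprodlexi /= => -[/andP[-> _] /andP[-> _]].
Qed.

Lemma fibre_funD f j m (t : int) : Fn n W f ->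
  fibre_fun f j (m + t * n%:Z)%R = (fibre_fun f j m + t * n%:Z)%R.
Proof. by move=> fn; rewrite /fibre_fun Fn_lex. Qed.

Lemma fibre_fun_above f j : Fn n W f -> exists m, (0 <= fibre_fun f j m)%R.
Proof.
move=> fn; exists (0 + `|fibre_fun f j 0| * n%:Z)%R.
by rewrite fibre_funD //; move: (fibre_fun f j 0) => x; nia.
Qed.

Lemma fibre_fun_below f j : Fn n W f -> exists m, (fibre_fun f j m < 0)%R.
Proof.
move=> fn; exists (0 + - (`|fibre_fun f j 0| + 1) * n%:Z)%R.
by rewrite fibre_funD //; move: (fibre_fun f j 0) => x; nia.
Qed.

(** [f] is unbounded in both directions on each fibre, so residuals stay in
    the fibres they come from. *)
Lemma fibre_map_lpl f j : Fn n W f -> fibre_map (lpl f) (fibre_map f j) = j.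
Proof.
move=> fn; have E t : (lpl f (fibre_map f j, 0%R) <= ((j, t) : W))%O =
    (0 <= fibre_fun f j t)%R.
  by rewrite lpl_adj fibre_mapE // lex_fibre_le.
have [t] := fibre_fun_above j fn; rewrite -E.
have [u] := fibre_fun_below j fn; rewrite ltNge -E -ltNge => /ltW.
rewrite !leEprodlexi /= => /andP[ju _] /andP[uj _].
by apply/le_anti; rewrite uj ju.
Qed.

Lemma fibre_map_lpr f j : Fn n W f -> fibre_map (lpr f) (fibre_map f j) = j.
Proof.
move=> fn; have E t : (((j, t) : W) <= lpr f (fibre_map f j, (-1)%R))%O =
    (fibre_fun f j t < 0)%R.
  by rewrite -lpr_adj fibre_mapE // lex_fibre_le; lia.
have Ef : fibre_map (lpr f) (fibre_map f j) = (lpr f (fibre_map f j, (-1)%R)).1.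
  by rewrite [in RHS]fibre_mapE //; apply: Fn_lpr.
have [t] := fibre_fun_below j fn; rewrite -E.
have [u] := fibre_fun_above j fn; rewrite leNgt -E -ltNge => /ltW.
rewrite !leEprodlexi /= => /andP[ju _] /andP[uj _].
by apply/le_anti; rewrite Ef uj ju.
Qed.

Lemma fibre_map_mono f j j' : Fn n W f ->
  (fibre_map f j <= fibre_map f j')%O = (j <= j')%O.
Proof.
have homo g : {homo fibre_map g : a b / (a <= b)%O}.
  move=> a b ab; have : (((a, 0%R) : W) <= ((b, 0%R) : W))%O.
    by rewrite lexi_pair ab lexx implybT.
  by move=> /(resmap_mono g); rewrite leEprodlexi => /andP[].
move=> fn; apply/idP/idP => [|/homo//].
by move=> /(homo (lpl f)); rewrite !fibre_map_lpl.
Qed.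

Lemma fibre_map_automorphism f : Fn n W f -> order_automorphism (fibre_map f).
Proof.
move=> fn; split; last by move=> j j'; exact: fibre_map_mono.
exists (fibre_map (lpl f)) => j; first exact: fibre_map_lpl.
by rewrite -[in fibre_map f](lpr_lpl f) fibre_map_lpr //; apply: Fn_lpl.
Qed.

Lemma fibre_fun_lpr f j p q : Fn n W f ->
  (fibre_fun f j p <= q)%O = (p <= fibre_fun (lpr f) (fibre_map f j) q)%O.
Proof.
move=> fn; rewrite -(lex_fibre_le (fibre_map f j)) -fibre_mapE // lpr_adj.
rewrite fibre_mapE; last exact: Fn_lpr.
by rewrite fibre_map_lpr // lex_fibre_le.
Qed.

Lemma fibre_fun_lpl f j p q : Fn n W f ->
  (fibre_fun (lpl f) (fibre_map f j) p <= q)%O = (p <= fibre_fun f j q)%O.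
Proof.
move=> fn; rewrite (fibre_fun_lpr _ _ _ (Fn_lpl fn)) lpr_lpl.
by rewrite fibre_map_lpl.
Qed.

(** The residuals of a component are components of the residuals, so the
    components are residuated to all orders. *)
Lemma fibre_fun_residuated f j : Fn n W f -> residuated (fibre_fun f j).
Proof.
move=> fn; apply: (residuated_coind
  (P := fun g => exists f j, Fn n W f /\ g = fibre_fun f j)); last by exists f, j.
move=> _ [{fn}f [{}j [fn ->]]].
exists (fibre_fun (lpr f) (fibre_map f j)), (fibre_fun (lpl f) (fibre_map f j)).
split; [|by move=> p q; rewrite fibre_fun_lpl| |].
- by move=> p q; rewrite fibre_fun_lpr.
- by exists (lpr f), (fibre_map f j); split=> //; apply: Fn_lpr.
- by exists (lpl f), (fibre_map f j); split=> //; apply: Fn_lpl.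
Qed.

Lemma decomposition_fibres f s fb : decomposition n f s fb ->
  s = fibre_map f /\ forall j, fb j =1 fibre_fun f j.
Proof.
by case=> _ _ fE; split=> [|j m]; [apply/funext => j|]; rewrite /fibre_map /fibre_fun fE.
Qed.

Lemma decomposition_exists f : Fn n W f -> exists s fb, decomposition n f s fb.
Proof.
move=> fn; exists (fibre_map f), (fun j => Resmap (fibre_fun_residuated j fn)).
split=> [|j|j m]; [exact: fibre_map_automorphism| |exact: fibre_mapE].
apply/(periodic_shift int_is_shift) => m /=.
by have := fibre_funD j m 1 fn; rewrite mul1r.
Qed.

Lemma tildeE f : Fn n W f -> tilde n f = fibre_map f.
Proof.
move=> /decomposition_exists[s ex]; rewrite /tilde.
have [fb dec] := xgetPex (id : J -> J)
  (P := [set s | exists fb, decomposition n f s fb]) (ex_intro _ s ex).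
by have [] := decomposition_fibres dec.
Qed.

Lemma barE f j m : Fn n W f -> bar n f j m = fibre_fun f j m.
Proof.
move=> /decomposition_exists[s [fb ex]]; rewrite /bar.
have [s' dec] := xgetPex ((fun=> 1%g) : J -> resmap int)
  (P := [set fb | exists s, decomposition n f s fb])
  (ex_intro _ fb (ex_intro _ s ex)).
by have [_ ->] := decomposition_fibres dec.
Qed.

End Fibres.

(** * A generator of F_n(Z) *)

Section Steps.
Local Open Scope ring_scope.
Implicit Types (b c p q t x : int).

Lemma lpbr_int (f : resmap int) (k : nat) x : lpbr f k x = f (x - k%:Z) + k%:Z.
Proof. exact: (lpbr_shift int_is_shift). Qed.

Context (n : nat) (n_gt0 : (0 < n)%N).

(** The [n]-periodic map with constant value [c] on the block [b, b + n[. *)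
Definition stepf b c x : int := c + ((x - b) %/ n%:Z)%Z * n%:Z.

Lemma stepf_adjoint b c : adjoint (stepf b c) (stepf c (b + n%:Z - 1)).
Proof.
move=> p q; rewrite /stepf.
have := (divz_eq (p - b) n%:Z, divz_eq (q - c) n%:Z).
have := (ltz_pmod (p - b) (_ : 0 < n%:Z)).
have := (ltz_pmod (q - c) (_ : 0 < n%:Z)).
have := (modz_ge0 (p - b) (_ : n%:Z != 0)).
have := (modz_ge0 (q - c) (_ : n%:Z != 0)).
move: ((p - b) %/ _)%Z ((p - b) %% _)%Z => u r.
move: ((q - c) %/ _)%Z ((q - c) %% _)%Z => v s.
move=> /(_ ltac:(lia)) s0 /(_ ltac:(lia)) r0 /(_ ltac:(lia)) sn /(_ ltac:(lia)) rn
  [pE qE].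
have [uv|vu] := leP u v.
  have : 0 <= (v - u) * n%:Z by nia.
  by rewrite mulrBl => ?; apply/idP/idP; lia.
have : 0 <= (u - v - 1) * n%:Z by nia.
by rewrite !mulrBl => ?; apply/idP/idP; lia.
Qed.

Lemma stepf_residuated b c : residuated (stepf b c).
Proof.
apply: (residuated_coind (P := fun g => exists b c, g = stepf b c)); last by exists b, c.
move=> _ [{}b [{}c ->]].
exists (stepf c (b + n%:Z - 1)), (stepf (c - n%:Z + 1) b); split.
- exact: stepf_adjoint.
- have -> : stepf b c = stepf b (c - n%:Z + 1 + n%:Z - 1) by congr stepf; lia.
  exact: stepf_adjoint.
- by do 2!eexists.
- by do 2!eexists.
Qed.

Definition step b c : resmap int := Resmap (stepf_residuated b c).

Lemma stepE b c x : step b c x = c + ((x - b) %/ n%:Z)%Z * n%:Z.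
Proof. by []. Qed.

Lemma step_lpr b c : lpr (step b c) = step c (b + n%:Z - 1).
Proof. by apply: lpr_unique; exact: stepf_adjoint. Qed.

Lemma step_mul b c b' c' : (step b c * step b' c')%g = step b' (step b c c').
Proof.
apply: resmap_ext => x; rewrite [LHS]/= !stepE /stepf.
rewrite [c' + _]addrC -[_ + c' - b]addrA divzMDl; last by lia.
by rewrite mulrDl addrCA addrC.
Qed.

Lemma step_lpbr b c (k : nat) : lpbr (step b c) k = step (b + k%:Z) (c + k%:Z).
Proof.
apply: resmap_ext => x; rewrite lpbr_int !stepE [RHS]addrAC.
by congr (_ + divz _ _ * _ + _); lia. Qed.

Lemma step_period b c t : step (b + t * n%:Z) (c + t * n%:Z) = step b c.
Proof.
apply: resmap_ext => x; rewrite !stepE opprD addrA -mulNr [x - b + _]addrC divzMDl; last by lia.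
by rewrite mulrDl mulNr -addrA [t * _ + _]addrA addrN add0r.
Qed.

Lemma Fn_intM (f : resmap int) t x : Fn n int f ->
  f (x + t * n%:Z) = f x + t * n%:Z.
Proof. exact: (periodic_shiftM int_is_shift). Qed.

Lemma step_le (f : resmap int) b : Fn n int f -> (step b (f b) <= f)%O.
Proof.
move=> fn; apply/resmap_leP => x; rewrite stepE -Fn_intM //.
apply: resmap_mono.
have := divz_eq (x - b) n%:Z; have := (modz_ge0 (x - b) (_ : n%:Z != 0)).
move=> /(_ ltac:(lia)); lia.
Qed.

(** The closure operator sending [x] to the least multiple of [n] that is at
    least [x]. *)
Definition ceilmul : resmap int := step 1 n%:Z.

Lemma ceilmul_dvd x : exists t, ceilmul x = t * n%:Z.
Proof. by rewrite stepE; exists (1 + ((x - 1) %/ n%:Z)%Z); lia. Qed.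

Lemma ceilmul_ge x : x <= ceilmul x.
Proof.
rewrite stepE; have := divz_eq (x - 1) n%:Z.
by have := ltz_pmod (x - 1) (_ : 0 < n%:Z) => /(_ ltac:(lia)); lia.
Qed.

Lemma ceilmul_idem : (ceilmul * ceilmul)%g = ceilmul.
Proof. by rewrite step_mul stepE divz_small ?mul0r ?addr0 //; lia. Qed.

Lemma ceilmul_Fn : Fn n int ceilmul.
Proof.
apply/periodic_lpbr; rewrite step_lpbr.
by have := step_period 1 n%:Z 1; rewrite mul1r.
Qed.

(** A map above the identity moves every point that it does not fix up by at
    least 1, and it cannot jump over a fixed point. *)
Lemma iter_ceilmul (g : resmap int) : Fn n int g -> (1%g <= g)%O -> g 0 = 0 ->
  (forall b : nat, (b < n)%N -> g b%:Z = b%:Z -> b = 0%N) ->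
  iter n g =1 ceilmul.
Proof.
move=> gn /resmap_leP g_ge g0 gfix x; rewrite stepE.
pose q := ((x - 1) %/ n%:Z)%Z; rewrite -/q.
have gM t y : g (y + t * n%:Z) = g y + t * n%:Z by apply: Fn_intM.
have gB : g (n%:Z + q * n%:Z) = n%:Z + q * n%:Z.
  by have := gM (1 + q) 0; rewrite g0 !add0r mulrDl mul1r.
have [qx xB] : q * n%:Z < x /\ x <= n%:Z + q * n%:Z.
  have := divz_eq (x - 1) n%:Z; rewrite -/q.
  have := modz_ge0 (x - 1) (_ : n%:Z != 0).
  have := ltz_pmod (x - 1) (_ : 0 < n%:Z).
  by move=> /(_ ltac:(lia)) ? /(_ ltac:(lia)); lia.
have climb (k : nat) : iter k g x <= n%:Z + q * n%:Z /\
    (x + k%:Z <= iter k g x \/ iter k g x = n%:Z + q * n%:Z).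
  elim: k => [|k]; first by split=> //; left; rewrite addr0.
  rewrite iterS; move: (iter k _ x) => y [yB].
  split; first by rewrite -gB; apply: resmap_mono.
  have [->|yB'] := eqVneq y (n%:Z + q * n%:Z); first by right.
  left; have xy : x + k%:Z <= y by lia.
  have [u uE] : exists u : nat, u%:Z = y - q * n%:Z.
    by exists (absz (y - q * n%:Z)%R); lia.
  have gy : g y != y.
    apply/eqP => gy; have : g u%:Z = u%:Z by rewrite uE -mulNr gM gy.
    by move=> /gfix; lia.
  by have /= := g_ge y; lia.
have [nB [nx|-> //]] := climb n.
lia.
Qed.

Lemma idem_fix (g : resmap int) x : (g * g)%g = g -> g (g x) = g x.
Proof. by move=> gg; rewrite -[LHS]/((g * g)%g x) gg. Qed.

(** Take [k] congruent to the fixed point [g 0]; then [g] fixes every value of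
    the right-hand side. *)
Lemma idem_le_ceilmul (g : resmap int) : Fn n int g -> (g * g)%g = g ->
  exists k : 'I_n, (g <= lpbr ceilmul k)%O.
Proof.
move=> gn gg; have gM t y : g (y + t * n%:Z) = g y + t * n%:Z by apply: Fn_intM.
have k_lt := ltz_pmod (g 0) (_ : 0 < n%:Z).
have k_ge := modz_ge0 (g 0) (_ : n%:Z != 0).
have kn : (absz (g 0 %% n%:Z)%Z < n)%N by lia.
have gk : g (absz (g 0 %% n%:Z)%Z)%:Z = (absz (g 0 %% n%:Z)%Z)%:Z.
  rewrite gez0_abs; last by lia.
  by rewrite /modz -mulNr gM idem_fix.
exists (Ordinal kn); move: gk => /=; move: (absz _) => k gk.
have [c_ge cE] : (forall x, x <= lpbr ceilmul k x) /\
    forall x, exists t, lpbr ceilmul k x = k%:Z + t * n%:Z.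
  split=> x; rewrite lpbr_int; first by have := ceilmul_ge (x - k%:Z); lia.
  by have [t ->] := ceilmul_dvd (x - k%:Z); exists t; rewrite addrC.
apply/resmap_leP => x; have [t tE] := cE x.
have <- : g (lpbr ceilmul k x) = lpbr ceilmul k x by rewrite tE gM gk.
exact: resmap_mono.
Qed.

(** A closure operator above [ceilmul] has a fixed point, all its fixed points
    are multiples of [n], and by periodicity all of them occur. *)
Lemma ceilmul_maximal (h : resmap int) : Fn n int h -> (h * h)%g = h ->
  (ceilmul <= h)%O -> h = ceilmul.
Proof.
move=> hn hh ch; have hM t y : h (y + t * n%:Z) = h y + t * n%:Z by apply: Fn_intM.
have [u uE] : exists u, h 0 = u * n%:Z.
  have [u uE] := ceilmul_dvd (h 0).
  exists u; rewrite -uE; apply/le_anti; rewrite ceilmul_ge /=.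
  by move/resmap_leP: ch => /(_ (h 0)); rewrite idem_fix.
have h0 : h 0 = 0.
  have := idem_fix 0 hh; rewrite {1}uE -[u * _]add0r hM uE; lia.
apply/le_anti; rewrite ch andbT; apply/resmap_leP => x.
have [t tE] := ceilmul_dvd x.
have <- : h (ceilmul x) = ceilmul x by rewrite tE -[t * _]add0r hM h0.
exact/resmap_mono/ceilmul_ge.
Qed.

Section Generation.
Context (N : set (resmap int)) (n_gt1 : (1 < n)%N) (SN : subalgebra N).

(** Only natural shifts come from [^[k]]; a negative one agrees with a natural
    one modulo [n]. *)
Lemma step_shift b c t : N (step b c) -> N (step (b + t) (c + t)).
Proof.
have [k kE] : exists k : nat, k%:Z = t + `|t| * n%:Z.
  by exists (absz (t + `|t| * n%:Z)); nia.
move=> /(@subalgebra_lpbr _ _ N _ k SN); rewrite step_lpbr kE !addrA.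
by rewrite step_period.
Qed.

(** By conjugation it is a question of the difference [d] between value and
    start of the block alone.  The generator gives [n - 1]; the right residual
    replaces [d] by [n - 1 - d], so it gives 0; multiplying by a suitable step
    of difference 0 replaces [d] by [d - 1], since [1 < n]. *)
Lemma step_all b c : N ceilmul -> N (step b c).
Proof.
move=> Ng; suff N0 d : N (step 0 d).
  by have := step_shift b (N0 (c - b)); rewrite add0r subrK.
have opp e : N (step 0 e) -> N (step 0 (n%:Z - 1 - e)).
  move=> /(subalg_lpr SN); rewrite step_lpr add0r => /(step_shift (- e)).
  by rewrite subrr.
have N00 : N (step 0 0).
  have /opp := step_shift (-1) Ng.
  by rewrite subrr.
have down e : N (step 0 e) -> N (step 0 (e - 1)).
  move=> /(subalg_mul SN (step_shift (e - 1) N00)); rewrite step_mul stepE add0r.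
  have -> : e - (e - 1) = 1 by lia.
  by rewrite divz_small ?mul0r ?addr0 //; lia.
have neg (k : nat) : N (step 0 (- k%:Z)).
  elim: k => [|k /down]; first by rewrite oppr0.
  by rewrite intS opprD addrC.
case: d => k; last by rewrite NegzE; exact: neg.
elim: k => [|k /opp/down/opp] //.
by congr (N (step _ _)); lia.
Qed.

(** [f] is the join of the steps below it that agree with it at a point of one
    period. *)
Lemma ceilmul_generates : N ceilmul -> Fn n int `<=` N.
Proof.
move=> Ng f fn.
have approx (m : nat) : exists g, [/\ N g, (g <= f)%O &
    forall b t, 0 <= b <= m%:Z -> g (b + t * n%:Z) = f (b + t * n%:Z)].
  elim: m => [|m [g [Ngm gf gE]]].
    exists (step 0 (f 0)); split; [exact: step_all|exact: step_le|] => b t b0.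
    by rewrite stepE Fn_intM // (_ : b = 0) ?add0r ?subr0 ?mulzK; lia.
  exists (g `|` step m.+1%:Z (f m.+1%:Z))%O; split.
  - by apply: (subalg_join SN) => //; apply: step_all.
  - by rewrite leUx gf step_le.
  - move=> b t bm; apply/le_anti/andP; split.
      suff /resmap_leP : (g `|` step m.+1%:Z (f m.+1%:Z) <= f)%O by [].
      by rewrite leUx gf step_le.
    have [bm'|bm'] := boolP (b <= m%:Z).
      by rewrite -gE ?lexUl //; lia.
    have -> : b = m.+1%:Z by lia.
    rewrite [leRHS]/= lexU; apply/orP; right.
    by rewrite Fn_intM // /stepf [m.+1%:Z + _]addrC addrK mulzK //; lia.
have [g [Ngn _ gE]] := approx n.
suff -> : f = g by [].
apply: resmap_ext => x; rewrite (divz_eq x n%:Z) addrC gE //.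
by rewrite modz_ge0 ?ltW ?ltz_pmod; lia.
Qed.

End Generation.
End Steps.

(** * The local subalgebra and its components *)

Section Local.
Local Open Scope ring_scope.
Context {d : Order.disp_t} {J : orderType d} (n : nat) (n_gt0 : (0 < n)%N).
Local Notation W := (J *l int)%type.
Implicit Types (i j : J) (m : int).
Context (L : set (resmap W)) (SL : subalgebra L) (LFn : L `<=` Fn n W).
Implicit Types a c e g h : resmap W.
Local Notation Lo := (Lloc n L).

Lemma LlocP c : L c -> Lo c <-> forall x, (c x).1 = x.1.
Proof.
move=> Lc; have cn := LFn Lc; rewrite /Lloc /= tildeE //; split=> [[_ cid] [j m]|cid].
  by rewrite (fibre_mapE n_gt0 _ _ cn) cid.
by split=> //; apply/funext => j; apply: cid.
Qed.

Lemma Lloc_Fn c : Lo c -> Fn n W c.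
Proof. by case=> /LFn. Qed.

Lemma LlocE c j m : Lo c -> c (j, m) = (j, bar n c j m).
Proof.
move=> cl; rewrite (barE n_gt0 _ _ (Lloc_Fn cl)).
by rewrite [LHS]surjective_pairing (LlocP cl.1).1.
Qed.

Lemma bar_Fn c j : Lo c -> Fn n int (bar n c j).
Proof.
move=> cl; apply/(periodic_shift int_is_shift) => m.
rewrite !(barE n_gt0 _ _ (Lloc_Fn cl)).
by have := fibre_funD j m 1 (Lloc_Fn cl); rewrite mul1r.
Qed.

Lemma Lloc_subalgebra : subalgebra Lo.
Proof.
split=> [|a b al bl|a b al bl|a b al bl|a al|a al].
- by apply/LlocP; [exact: subalg_one SL|].
- apply/LlocP; first exact: subalg_mul SL _ _ al.1 bl.1.
  by case=> j m; rewrite /= !LlocE.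
- apply/LlocP; first exact: subalg_meet SL _ _ al.1 bl.1.
  by case=> j m; rewrite /= !LlocE // meetEtotal minEle; case: ifP.
- apply/LlocP; first exact: subalg_join SL _ _ al.1 bl.1.
  by case=> j m; rewrite /= !LlocE // joinEtotal maxEle; case: ifP.
- have Fa := Lloc_Fn al; split; first exact: subalg_lpl SL _ al.1.
  rewrite /= tildeE ?tildeE //; last exact: Fn_lpl.
  apply/funext => j; rewrite -[RHS](fibre_map_lpl n_gt0 j Fa); congr fibre_map.
  by have := al.2; rewrite /= tildeE // => ->.
- have Fa := Lloc_Fn al; split; first exact: subalg_lpr SL _ al.1.
  rewrite /= tildeE ?tildeE //; last exact: Fn_lpr.
  apply/funext => j; rewrite -[RHS](fibre_map_lpr n_gt0 j Fa); congr fibre_map.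
  by have := al.2; rewrite /= tildeE // => ->.
Qed.

Lemma bar_one j : bar n (1%g : resmap W) j = 1%g.
Proof.
apply: resmap_ext => m; have := LlocE j m (subalg_one Lloc_subalgebra).
by case.
Qed.

Lemma bar_mul a c j : Lo a -> Lo c -> bar n (a * c)%g j = (bar n a j * bar n c j)%g.
Proof.
move=> al cl; apply: resmap_ext => m.
have := LlocE j m (subalg_mul Lloc_subalgebra al cl).
by rewrite /= !LlocE // => -[].
Qed.

Lemma bar_meet a c j : Lo a -> Lo c ->
  bar n (a `&` c)%O j = (bar n a j `&` bar n c j)%O.
Proof.
move=> al cl; apply: resmap_ext => m.
have := LlocE j m (subalg_meet Lloc_subalgebra al cl).
rewrite /= !LlocE // !meetEtotal !minEle lex_fibre_le.
by case: ifP => _ [].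
Qed.

Lemma bar_join a c j : Lo a -> Lo c ->
  bar n (a `|` c)%O j = (bar n a j `|` bar n c j)%O.
Proof.
move=> al cl; apply: resmap_ext => m.
have := LlocE j m (subalg_join Lloc_subalgebra al cl).
rewrite /= !LlocE // !joinEtotal !maxEle lex_fibre_le.
by case: ifP => _ [].
Qed.

Lemma bar_lpl c j : Lo c -> bar n (lpl c) j = lpl (bar n c j).
Proof.
move=> cl; apply/esym/lpl_unique => p q.
have ll := subalg_lpl Lloc_subalgebra cl.
by rewrite -!(lex_fibre_le j) -!LlocE // lpl_adj.
Qed.

Lemma bar_lpr c j : Lo c -> bar n (lpr c) j = lpr (bar n c j).
Proof.
move=> cl; apply/esym/lpr_unique => p q.
have ll := subalg_lpr Lloc_subalgebra cl.
by rewrite -!(lex_fibre_le j) -!LlocE // lpr_adj.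
Qed.

Lemma bar_lpbr c j k : Lo c -> bar n (lpbr c k) j = lpbr (bar n c j) k.
Proof.
move=> cl; elim: k => // k IH.
have ll := subalgebra_lpbr k Lloc_subalgebra cl.
by rewrite !lpbrS !bar_lpl ?IH //; apply: subalg_lpl Lloc_subalgebra _ ll.
Qed.

Lemma bar_mono a c j : Lo a -> Lo c -> (a <= c)%O -> (bar n a j <= bar n c j)%O.
Proof.
move=> al cl /resmap_leP ac; apply/resmap_leP => m.
by rewrite -(lex_fibre_le j) -!LlocE.
Qed.

(** What is used of membership in the common support of the elements
    of L_loc other than 1. *)
Definition faithful_at j := forall c, Lo c -> bar n c j = 1%g -> c = 1%g.

(** [a <= c] says that the meet of 1 and [lpr a * c] is 1, which can be
    checked at [j]. *)
Lemma bar_le j a c : faithful_at j -> Lo a -> Lo c ->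
  (bar n a j <= bar n c j)%O -> (a <= c)%O.
Proof.
move=> Fj al cl ac; apply/le_lpr_mul.
have rl := subalg_lpr Lloc_subalgebra al.
have rcl := subalg_mul Lloc_subalgebra rl cl.
have ol := subalg_one Lloc_subalgebra.
apply/meet_idPl; apply: Fj; first exact: subalg_meet Lloc_subalgebra _ _ ol rcl.
rewrite (bar_meet j ol rcl) bar_one (bar_mul j rl cl) (bar_lpr j al).
exact/meet_idPl/(le_lpr_mul _ _).1.
Qed.

Lemma bar_inj j a c : faithful_at j -> Lo a -> Lo c ->
  bar n a j = bar n c j -> a = c.
Proof.
move=> Fj al cl ac.
by apply/le_anti; rewrite !(bar_le Fj) // ac.
Qed.

(** * Fixed points of closure operators *)

Lemma Lloc_lpr_mul a : L a -> Lo (lpr a * a)%g.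
Proof.
move=> La; have Fa := LFn La; apply/LlocP => [|[j m]].
  exact: subalg_mul SL _ _ (subalg_lpr SL La) La.
rewrite [X in X.1](_ : _ = lpr a (a (j, m))) //.
rewrite (fibre_mapE n_gt0 _ _ Fa) (fibre_mapE n_gt0 _ _ (Fn_lpr Fa)).
exact: (fibre_map_lpr n_gt0 j Fa).
Qed.

Lemma Lloc_mul_lpl a : L a -> Lo (a * lpl a)%g.
Proof. by move=> La; rewrite -{1}(lpr_lpl a); apply/Lloc_lpr_mul/(subalg_lpl SL). Qed.

(** For maps above the identity, the fixed points of a product are the common
    fixed points of the factors; so any [g] with the least number of fixed
    points modulo [n] will do. *)
Lemma exists_least_fixed_points i : exists g, [/\ Lo g, (1%g <= g)%O,
  bar n g i 0 = 0 & forall c, Lo c -> (1%g <= c)%O -> bar n c i 0 = 0 ->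
  forall b : nat, (b < n)%N -> bar n g i b%:Z = b%:Z -> bar n c i b%:Z = b%:Z].
Proof.
pose Fix c := finset (fun t : 'I_n => bar n c i (t : nat)%:Z == (t : nat)%:Z).
pose cand c := [/\ Lo c, (1%g <= c)%O & bar n c i 0 = 0].
have cand1 : cand 1%g.
  split=> //; first exact: subalg_one Lloc_subalgebra.
  by rewrite bar_one.
pose P k := `[< exists2 c, cand c & #|Fix c| = k >].
have exP : exists k, P k by exists #|Fix 1%g|; apply/asboolP; exists 1%g.
case: (ex_minnP exP) => k /asboolP[g [gl g1 g0] gk] kmin.
exists g; split=> // c cl c1 c0 b bn gb.
have cgl := subalg_mul Lloc_subalgebra cl gl.
have cgE x : bar n (c * g)%g i x = bar n c i (bar n g i x) by rewrite bar_mul.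
have bar_ge1 h x : Lo h -> (1%g <= h)%O -> x <= bar n h i x.
  move=> hl h1; have ol := subalg_one Lloc_subalgebra.
  have /resmap_leP := bar_mono i ol hl h1.
  by rewrite bar_one => /(_ x).
have fixcg x : bar n (c * g)%g i x = x -> bar n g i x = x /\ bar n c i x = x.
  rewrite cgE => cgx; have gx : bar n g i x = x.
    by apply/le_anti; rewrite bar_ge1 // -{2}cgx bar_ge1.
  by move: cgx; rewrite gx.
have sub : Fix (c * g)%g \subset Fix g.
  by apply/fintype.subsetP => t; rewrite /Fix !inE => /eqP/fixcg[->].
have /eqP eqF : Fix (c * g)%g == Fix g.
  rewrite eqEcard sub gk; apply: kmin; apply/asboolP; exists (c * g)%g => //.
  split; [exact: cgl| |by rewrite cgE g0].
  by have := lp_mul_le _ _ _ _ c1 g1; rewrite mulg1.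
have : Ordinal bn \in Fix g by rewrite /Fix inE gb.
by rewrite -eqF /Fix inE /= => /eqP/fixcg[].
Qed.

(** Conjugating [e] by the shift that moves a fixed point [x] to 0 gives an
    element to which the hypothesis on [b] applies, so that [x + b] is fixed
    too.  Since [e x] is the least fixed point above [x], this gives
    [e (x + b) <= e x + b]. *)
Lemma lpbr_fix_idempotent i e (b : nat) : faithful_at i ->
  (forall c, Lo c -> (1%g <= c)%O -> bar n c i 0 = 0 -> bar n c i b%:Z = b%:Z) ->
  Lo e -> (1%g <= e)%O -> (e * e)%g = e -> lpbr e b = e.
Proof.
move=> Fi fixb el e1 ee; have eE x : bar n e i (bar n e i x) = bar n e i x.
  by rewrite -[LHS]/((bar n e i * bar n e i)%g x) -bar_mul // ee.
have bl := subalgebra_lpbr b Lloc_subalgebra el.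
have fix_shift x : bar n e i x = x -> bar n e i (x + b%:Z) = x + b%:Z.
  move=> ex; have [k [t kE]] : exists k : nat, exists t, k%:Z = t * n%:Z - x.
    by exists (absz (`|x| * n%:Z - x)%R), `|x|%R; nia.
  have kl := subalgebra_lpbr k Lloc_subalgebra el.
  have eN y : bar n e i (y - t * n%:Z) = bar n e i y - t * n%:Z.
    by rewrite -mulNr (Fn_intM _ _ (bar_Fn i el)).
  have k1 : (1%g <= lpbr e k)%O.
    by rewrite -(lpbr1 lex_is_shift k); apply: (lpbr_le lex_is_shift).
  have k0 : bar n (lpbr e k) i 0 = 0.
    rewrite bar_lpbr // lpbr_int kE.
    by rewrite (_ : 0 - _ = x - t * n%:Z) ?eN ?ex; lia.
  have := fixb _ kl k1 k0; rewrite bar_lpbr // lpbr_int kE.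
  by rewrite (_ : b%:Z - _ = x + b%:Z - t * n%:Z) ?eN; lia.
apply: (lpbr_fix_of_le lex_is_shift n_gt0 (Lloc_Fn el)).
apply: (bar_le Fi) => //; apply/resmap_leP => x.
rewrite bar_lpbr // lpbr_int -fix_shift; last exact: eE.
apply: resmap_mono; rewrite -lerBlDr.
have /resmap_leP := bar_mono i (subalg_one Lloc_subalgebra) el e1.
by rewrite bar_one; apply.
Qed.

(** * The components are isomorphisms onto F_n(Z) *)

Context (a : resmap W) (La : L a) (a_periodicity : elt_periodicity a n).

(** A fixed point [b] of the least [g] with [0 < b < n] would make the two
    closure operators built from [a] invariant under [^[b]], and then [a]
    would be [b]-periodic.  So a power of [g] has component [ceilmul]. *)
Lemma exists_bar_ceilmul i : faithful_at i ->
  exists2 h, Lo h & bar n h i = ceilmul n_gt0.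
Proof.
move=> Fi; have [g [gl g1 g0 gleast]] := exists_least_fixed_points i.
have gfix (b : nat) : (b < n)%N -> bar n g i b%:Z = b%:Z -> b = 0%N.
  move=> bn gb; have idem e : Lo e -> (1%g <= e)%O -> (e * e)%g = e -> lpbr e b = e.
    apply: (lpbr_fix_idempotent Fi) => c cl c1 c0.
    exact: gleast gb.
  have ab : lpbr a b = a.
    apply: (lpbr_fix_of_lpr_lpl lex_is_shift n_gt0 (LFn La)); apply: idem.
    - exact: Lloc_lpr_mul.
    - exact: lp_rmul_ge1.
    - exact: lpr_mul_idem.
    - exact: Lloc_mul_lpl.
    - exact: lp_mull_ge1.
    - exact: mul_lpl_idem.
  case: b bn ab {gb idem} => // b bn /periodic_lpbr ab.
  have [_ _ /(_ b.+1 isT ab)] := a_periodicity.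
  by rewrite leqNgt bn.
have power (k : nat) :
    exists2 h, Lo h & forall x, bar n h i x = iter k (bar n g i) x.
  elim: k => [|k [h hl hE]].
    by exists 1%g; [exact: subalg_one Lloc_subalgebra|rewrite bar_one].
  exists (g * h)%g; first exact: subalg_mul Lloc_subalgebra _ _ gl hl.
  by move=> x; rewrite bar_mul // /= hE.
have [h hl hE] := power n.
exists h => //; apply: resmap_ext => x; rewrite hE.
apply: iter_ceilmul => //; first exact: bar_Fn.
by rewrite -(bar_one i); apply: bar_mono => //; exact: subalg_one Lloc_subalgebra.
Qed.

Context (n_gt1 : (1 < n)%N).

Lemma bar_surj i f : faithful_at i -> Fn n int f -> exists2 c, Lo c & bar n c i = f.
Proof.
move=> Fi; pose N := [set f | exists2 c, Lo c & bar n c i = f].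
have SLo := Lloc_subalgebra; suff SN : subalgebra N.
  by move: f; apply: (ceilmul_generates n_gt1 SN); apply: exists_bar_ceilmul.
split=> [|_ _ [b bl <-] [c cl <-]|_ _ [b bl <-] [c cl <-]|_ _ [b bl <-] [c cl <-]
        |_ [b bl <-]|_ [b bl <-]].
- by exists 1%g; [exact: subalg_one SLo|exact: bar_one].
- by exists (b * c)%g; [exact: subalg_mul SLo _ _ bl cl|exact: bar_mul].
- by exists (b `&` c)%O; [exact: subalg_meet SLo _ _ bl cl|exact: bar_meet].
- by exists (b `|` c)%O; [exact: subalg_join SLo _ _ bl cl|exact: bar_join].
- by exists (lpl b); [exact: subalg_lpl SLo _ bl|exact: bar_lpl].
- by exists (lpr b); [exact: subalg_lpr SLo _ bl|exact: bar_lpr].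
Qed.

(** Let [g] and [h] be the elements of L_loc whose component at [i],
    respectively at [j], is [ceilmul], respectively [ceilmul^[k]] for a
    suitable [k].  Then [g = h], so the elements whose two components are
    related by [^[k]] include [g], and the subalgebra that they form is
    mapped onto F_n(Z) by the component at [i]. *)
Lemma bar_conjugate i j : faithful_at i -> faithful_at j ->
  exists k : 'I_n, forall c, Lo c -> bar n c j = lpbr (bar n c i) k.
Proof.
move=> Fi Fj; have SLo := Lloc_subalgebra.
have idem l c (e : resmap int) : faithful_at l -> Lo c -> bar n c l = e -> (e * e)%g = e ->
    (c * c)%g = c.
  move=> Fl cl <- ee; have ccl := subalg_mul SLo cl cl.
  by apply: (bar_inj Fl) => //; rewrite bar_mul.
have bar_idem l c : Lo c -> (c * c)%g = c -> (bar n c l * bar n c l)%g = bar n c l.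
  by move=> cl cc; rewrite -bar_mul // cc.
have [g gl gE] := exists_bar_ceilmul Fi.
have gg := idem i g _ Fi gl gE (ceilmul_idem n_gt0).
have [k gk] := idem_le_ceilmul n_gt0 (bar_Fn j gl) (bar_idem j g gl gg).
have ceil_Fn : Fn n int (lpbr (ceilmul n_gt0) k).
  have /periodic_lpbr cn := ceilmul_Fn n_gt0.
  by apply/periodic_lpbr; rewrite -lpbrD addnC lpbrD cn.
have ceil_idem : (lpbr (ceilmul n_gt0) k * lpbr (ceilmul n_gt0) k)%g =
    lpbr (ceilmul n_gt0) k by rewrite -(lpbr_mul int_is_shift) ceilmul_idem.
exists k; have [h hl hE] := bar_surj Fj ceil_Fn.
have hh := idem j h _ Fj hl hE ceil_idem.
have gh : (g <= h)%O by apply: (bar_le Fj) => //; rewrite hE.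
(* At i the component of g is ceilmul, which is maximal, so g <= h is an
   equality there. *)
have hgE : h = g.
  apply: (bar_inj Fi) => //; rewrite gE; apply: ceilmul_maximal.
  - exact: bar_Fn.
  - exact: bar_idem.
  - by rewrite -gE; apply: bar_mono.
pose N := [set f | exists c, [/\ Lo c, bar n c i = f & bar n c j = lpbr f k]].
suff SN : subalgebra N.
  have FN : Fn n int `<=` N.
    apply: (ceilmul_generates n_gt1 SN); exists g; split=> //.
    by rewrite -[RHS]hE hgE.
  move=> c cl; have [c' [c'l c'i <-]] := FN _ (bar_Fn i cl).
  by rewrite (bar_inj Fi c'l cl c'i).
split=> [|_ _ [b [bl <- bj]] [c [cl <- cj]]|_ _ [b [bl <- bj]] [c [cl <- cj]]
        |_ _ [b [bl <- bj]] [c [cl <- cj]]|_ [b [bl <- bj]]|_ [b [bl <- bj]]].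
- exists 1%g; split; first exact: subalg_one SLo.
    exact: bar_one.
  by rewrite bar_one (lpbr1 int_is_shift).
- exists (b * c)%g; split; first exact: subalg_mul SLo _ _ bl cl.
    exact: bar_mul.
  by rewrite bar_mul // (lpbr_mul int_is_shift) bj cj.
- exists (b `&` c)%O; split; first exact: subalg_meet SLo _ _ bl cl.
    exact: bar_meet.
  by rewrite bar_meet // (lpbr_meet int_is_shift) bj cj.
- exists (b `|` c)%O; split; first exact: subalg_join SLo _ _ bl cl.
    exact: bar_join.
  by rewrite bar_join // (lpbr_join int_is_shift) bj cj.
- exists (lpl b); split; first exact: subalg_lpl SLo _ bl.
    exact: bar_lpl.
  by rewrite bar_lpl // lpbr_lpl bj.
- exists (lpr b); split; first exact: subalg_lpr SLo _ bl.
    exact: bar_lpr.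
  by rewrite bar_lpr // lpbr_lpr bj.
Qed.

End Local.

(** * Points of the common support *)

Lemma faithful_supp_loc (d : Order.disp_t) (J : orderType d) (n : nat)
    (L : set (resmap (J *l int)%type)) j :
  supp_loc n L j -> faithful_at n L j.
Proof.
rewrite /supp_loc; case: xgetP => [S _ /= SE|//] Sj c cl cj.
apply: contrapT => c1.
have : [set supp n f | f in Lloc n L `\ 1%g] (supp n c) by exists c.
by rewrite SE => cS; move: Sj; rewrite -cS; apply.
Qed.

Theorem theorem6p6 (d : Order.disp_t) (J : orderType d) (n : nat)
    (L : set (resmap (J *l int)%type)) (i : J)
    (L_sub : subalgebra L) (L_Fn : L `<=` Fn n (J *l int)%type)
    (L_proper : is_proper L) (L_periodicity : has_periodicity L n)
    (Lg_total : total_on (skeleton L) (fun a b => (a <= b)%O))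
    (Si : supp_loc n L i) :
  (exists k : J -> 'I_n,
     (forall (c : resmap (J *l int)%type) (j : J),
        Lloc n L c -> supp_loc n L j -> bar n c j = lpbr (bar n c i) (k j)) /\
     k i = 0%N :> nat) /\
  isomorphic (Lloc n L) (Fn n int).
Proof.
have [_ [a La a_per]] := L_periodicity.
have n_gt0 : (0 < n)%N by case: a_per.
have n_gt1 : (1 < n)%N.
  rewrite ltn_neqAle n_gt0 andbT; apply/eqP => n1; apply: L_proper.
  by apply/seteqP; split=> [c []//|c Lc]; split=> //; have := L_Fn c Lc; rewrite -n1.
have Fi := faithful_supp_loc Si; split.
  have /choice[k kP] j : exists kj : 'I_n, (supp_loc n L j ->
      forall c, Lloc n L c -> bar n c j = lpbr (bar n c i) kj) /\
      (j = i -> kj = 0%N :> nat).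
    have [->|ij] := eqVneq j i; first by exists (Ordinal n_gt0).
    have [Sj|nSj] := pselect (supp_loc n L j); last first.
      by exists (Ordinal n_gt0); split=> // ji; rewrite ji eqxx in ij.
    have [k kE] := bar_conjugate n_gt0 L_sub L_Fn La a_per n_gt1 Fi (faithful_supp_loc Sj).
    by exists k; split=> // ji; rewrite ji eqxx in ij.
  exists k; split=> [c j cl Sj|]; first exact: (kP j).1.
  exact: (kP i).2.
exists (fun c => bar n c i); split.
- split=> [c cl|c e /set_mem cl /set_mem el|f fn].
  + exact: bar_Fn cl.
  + exact: (bar_inj n_gt0 L_sub L_Fn Fi).
  + by have [c cl <-] := bar_surj n_gt0 L_sub L_Fn La a_per n_gt1 Fi fn; exists c.
- exact: (bar_one n_gt0 L_sub L_Fn).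
- by move=> c e /set_mem cl /set_mem el; apply: (bar_mul n_gt0 L_sub L_Fn).
- by move=> c e /set_mem cl /set_mem el; apply: (bar_meet n_gt0 L_sub L_Fn).
- by move=> c e /set_mem cl /set_mem el; apply: (bar_join n_gt0 L_sub L_Fn).
- by move=> c /set_mem cl; apply: (bar_lpl n_gt0 L_sub L_Fn).
- by move=> c /set_mem cl; apply: (bar_lpr n_gt0 L_sub L_Fn).
Qed.
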